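(* Let $d \in \mathbb N$ and $f \in \mathcal C^\infty(\mathbb R^d)$ be real-valued. Then there exists a sequence $(p_n)_{n \in \mathbb N}$ of polynomials in $d$ variables with rational coefficients such that for each compact $K \subset \mathbb R^d$ and each multiindex $\beta \in \mathbb N_0^d$, $$\|\partial^\beta f - \partial^\beta p_n\|_{\mathcal C(K)} \longrightarrow 0 \quad (n \to \infty).$$
   Context: For $\beta = (\beta_1,\ldots,\beta_d) \in \mathbb N_0^d$, $\partial^\beta f := \frac{\partial^{\beta_1}}{\partial x_1^{\beta_1}} \cdots \frac{\partial^{\beta_d}}{\partial x_d^{\beta_d}} f$. For compact $K$, $\|g\|_{\mathcal C(K)} := \sup_{x \in K} |g(x)|$. *)

(* Defs.v *)
From mathcomp Require Import all_boot all_order all_algebra.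
From mathcomp Require mpoly.
From mathcomp Require Import all_classical all_reals all_analysis.
Import Order.TTheory GRing.Theory Num.Theory.
Import numFieldNormedType.Exports.

Set Implicit Arguments.
Unset Strict Implicit.
Unset Printing Implicit Defensive.

Local Open Scope classical_set_scope.
Local Open Scope ring_scope.

Definition partial (R : realType) (d : nat) (i : 'I_d) (f : 'rV[R]_d -> R)
  : 'rV[R]_d -> R :=
  fun x => 'D_(delta_mx 0 i) f x.

(* [:: i1; ...; ik] is the order k derivative d/dx_i1 ... d/dx_ik f. *)
Definition iter_partial (R : realType) (d : nat) (s : seq 'I_d)
    (f : 'rV[R]_d -> R) : 'rV[R]_d -> R :=
  foldr (@partial R d) f s.

(* The factor of the lowest coordinate is applied last, as in
   (d/dx_1)^(beta_1) ... (d/dx_d)^(beta_d) f. *)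
Definition mpartial (R : realType) (d : nat) (beta : 'I_d -> nat)
    (f : 'rV[R]_d -> R) : 'rV[R]_d -> R :=
  foldr (fun i g => iter (beta i) (partial i) g) f (enum 'I_d).

(* Partial derivatives of all orders, in whatever order of the coordinates,
   exist and are continuous. Existence has to be required separately because
   ['D_v f x] is a total function. *)
Definition smooth (R : realType) (d : nat) (f : 'rV[R]_d -> R) : Prop :=
  forall s : seq 'I_d,
    continuous (iter_partial s f) /\
    (forall (i : 'I_d) (x : 'rV[R]_d),
       derivable (iter_partial s f) x (delta_mx 0 i)).

(* [sup] is real-valued: it is the supremum whenever g is bounded on K, in
   particular for g continuous and K compact, and it is 0 for K empty. *)
Definition sup_norm (R : realType) (d : nat) (K : set 'rV[R]_d)
    (g : 'rV[R]_d -> R) : R :=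
  sup [set `|g x| | x in K].

Definition rat_mpoly_fun (R : realType) (d : nat) (p : mpoly.mpoly d rat)
  : 'rV[R]_d -> R :=
  fun x => mpoly.meval (fun i => x 0 i) (mpoly.map_mpoly (@ratr R) p).

(* Main.v *)
Require Import Defs.
From mathcomp Require Import all_boot all_order all_algebra.
From mathcomp Require Import -(notations) mpoly.
From mathcomp Require Import all_classical all_reals all_analysis.
From mathcomp Require Import ring lra.
Import Order.TTheory GRing.Theory Num.Theory.
Import numFieldNormedType.Exports.

(** Approximate in one coordinate at a time, and in each coordinate approximate
    the highest derivative first and integrate afterwards.

    Fix a coordinate [i], an order [n], a cube and a tolerance. If only the
    derivatives that do not involve [i] have to be controlled, the Bernstein
    operator in the variable [x_i] does it: it replaces [f] by a finite sum of
    terms [phi_k(x_i) * f(x with x_i := t_k)], where the [phi_k] are polynomials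
    with rational coefficients. This commutes with the derivatives in the other
    variables, and the error is a mean of increments of a function that is
    Lipschitz in [x_i] ([separated_approx0]). To control one more derivative in
    [x_i], approximate the partial derivative of [f] in the direction [i] in
    this way, take the antiderivative in [x_i] of the approximant that vanishes
    on [x_i = 0], and add the restriction of [f] to [x_i = 0]. The error then
    vanishes on [x_i = 0] and has a small derivative in [x_i], so that it is
    small by the mean value theorem ([separated_approx]). This step needs
    partial derivatives to commute ([schwarz]).

    The coefficients [f(x with x_i := t_k)], and those that come from the
    derivatives of [f], are smooth and depend on one variable fewer. By
    induction on the number of variables they are themselves limits of rational
    polynomials ([depends_lt_approximable]); multiplication by a fixed
    polynomial is continuous for the C^n norms on a cube by the Leibniz rule
    ([Cn_leM]). In the base case the coefficients are real constants, and this
    is the only place where reals are replaced by rationals. A diagonal choice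
    (order, cube and tolerance governed by the same [n]) gives the sequence. *)

Set Implicit Arguments.
Unset Strict Implicit.
Unset Printing Implicit Defensive.

Local Open Scope classical_set_scope.
Local Open Scope ring_scope.

(** * Smooth functions and partial derivatives *)

Section SmoothFunctions.
Variables (R : realType) (d : nat).
Local Notation V := 'rV[R]_d.
Local Notation e i := (delta_mx 0 i : V).
Implicit Types (f g h : V -> R) (x y : V) (i j l : 'I_d) (s : seq 'I_d).

Lemma iter_partial_cat s1 s2 f :
  iter_partial (s1 ++ s2) f = iter_partial s1 (iter_partial s2 f).
Proof. exact: foldr_cat. Qed.

Lemma iter_partial_rcons s i f :
  iter_partial (rcons s i) f = iter_partial s (partial i f).
Proof. by rewrite -cats1 iter_partial_cat. Qed.

Lemma smooth_continuous f : smooth f -> continuous f.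
Proof. by move=> /(_ [::])[]. Qed.

Lemma smooth_derivable f i x : smooth f -> derivable f x (e i).
Proof. by move=> /(_ [::])[_]; exact. Qed.

Lemma smooth_iter_partial s f : smooth f -> smooth (iter_partial s f).
Proof. by move=> sf t; rewrite -iter_partial_cat; exact: sf. Qed.

Lemma smooth_partial i f : smooth f -> smooth (partial i f).
Proof. exact: (@smooth_iter_partial [:: i]). Qed.

(** A class of functions that is closed under partial differentiation and has
    continuous, partially derivable members consists of smooth functions. This
    yields the closure properties of [smooth] below. *)
Lemma smooth_coind (C : (V -> R) -> Prop) :
  (forall f, C f -> continuous f /\
     forall i, (forall x, derivable f x (e i)) /\ C (partial i f)) ->
  forall f, C f -> smooth f.
Proof.
move=> CP f Cf s; have Cs : C (iter_partial s f).
  by elim: s => [//|i s IH] /=; exact: ((CP _ IH).2 i).2.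
by have [cs ds] := CP _ Cs; split=> // i; exact: (ds i).1.
Qed.

End SmoothFunctions.

(* Keeps unification from comparing two smoothness statements by their
   definition. *)
#[local] Opaque smooth.

Section PartialDerivatives.
Variables (R : realType) (d : nat).
Local Notation V := 'rV[R]_d.
Local Notation e i := (delta_mx 0 i : V).
Implicit Types (f g h : V -> R) (x y : V) (i j l : 'I_d) (s : seq 'I_d).

Lemma partial_cst i (c : R) : partial i (cst c : V -> R) = cst 0.
Proof. by apply/funext => x; rewrite /partial derive_cst. Qed.

Lemma smooth_cst (c : R) : smooth (cst c : V -> R).
Proof.
apply: (@smooth_coind R d (fun f => exists c, f = cst c)); last by exists c.
move=> _ [{}c ->]; split=> [x|i]; first exact: cst_continuous.
by split; [move=> x; exact: derivable_cst|exists 0; rewrite partial_cst].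
Qed.

Lemma partialD i f g : smooth f -> smooth g ->
  partial i (f + g) = partial i f + partial i g.
Proof.
by move=> sf sg; apply/funext => x; rewrite /partial deriveD //;
  exact: smooth_derivable.
Qed.

Lemma smoothD f g : smooth f -> smooth g -> smooth (f + g).
Proof.
move=> sf sg; apply: (@smooth_coind R d (fun F => exists f g,
  [/\ smooth f, smooth g & F = f + g])); last by exists f, g.
move=> _ [f1 [g1 [sf1 sg1 ->]]]; split=> [x|i].
  by apply: continuousD; exact: smooth_continuous.
split=> [x|]; first by apply: derivableD; exact: smooth_derivable.
exists (partial i f1), (partial i g1).
by split; [exact: smooth_partial|exact: smooth_partial|exact: partialD].
Qed.

Lemma iter_partialD s f g : smooth f -> smooth g ->
  iter_partial s (f + g) = iter_partial s f + iter_partial s g.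
Proof.
move=> sf sg; elim: s => //= i s ->.
by apply: partialD; exact: smooth_iter_partial.
Qed.

Lemma partialM i f g : smooth f -> smooth g ->
  partial i (f * g) = f * partial i g + partial i f * g.
Proof.
move=> sf sg; apply/funext => x; rewrite /partial deriveM; last 2 first.
- exact: smooth_derivable.
- exact: smooth_derivable.
by rewrite [X in _ + X]mulrC.
Qed.

(** The Leibniz rule leaves the products of two smooth functions; their finite
    sums form a class stable under differentiation. *)
Inductive prod_sum : (V -> R) -> Prop :=
| prod_sumM f g of smooth f & smooth g : prod_sum (f * g)
| prod_sumD f g of prod_sum f & prod_sum g : prod_sum (f + g).

Lemma smoothM f g : smooth f -> smooth g -> smooth (f * g).
Proof.
move=> sf sg; apply: (@smooth_coind R d prod_sum); last exact: prod_sumM.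
move=> F {f g sf sg}; elim=> {F} [f g sf sg|f g _ [cf df] _ [cg dg]].
  split=> [x|i]; first by apply: continuousM; exact: smooth_continuous.
  split=> [x|]; first by apply: derivableM; exact: smooth_derivable.
  rewrite partialM//; apply: prod_sumD.
    exact: prod_sumM sf (smooth_partial i sg).
  exact: prod_sumM (smooth_partial i sf) sg.
split=> [x|i]; first by apply: continuousD; [exact: cf|exact: cg].
have [[dfi pf] [dgi pg]] := (df i, dg i).
split=> [x|]; first exact: derivableD.
rewrite (_ : partial i (f + g) = partial i f + partial i g).
  exact: prod_sumD.
by apply/funext => x; rewrite /partial deriveD.
Qed.

Lemma smoothN f : smooth f -> smooth (- f).
Proof.
move=> sf; rewrite (_ : - f = cst (-1) * f).
  exact: smoothM (@smooth_cst (-1)) sf.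
by apply/funext => x; rewrite /GRing.opp/= /GRing.mul/= mulN1r.
Qed.

Lemma smoothB f g : smooth f -> smooth g -> smooth (f - g).
Proof. by move=> sf sg; exact: smoothD sf (smoothN sg). Qed.

Lemma partialN i f : smooth f -> partial i (- f) = - partial i f.
Proof.
move=> sf; apply/funext => x; rewrite /partial deriveN//.
exact: smooth_derivable.
Qed.

Lemma iter_partialN s f : smooth f ->
  iter_partial s (- f) = - iter_partial s f.
Proof.
move=> sf; elim: s => //= i s ->.
by apply: partialN; exact: smooth_iter_partial.
Qed.

Lemma iter_partialB s f g : smooth f -> smooth g ->
  iter_partial s (f - g) = iter_partial s f - iter_partial s g.
Proof.
by move=> sf sg; rewrite (iter_partialD s sf (smoothN sg)) iter_partialN.
Qed.

Lemma iter_partial0 s : iter_partial s (0 : V -> R) = 0.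
Proof. by elim: s => //= i s ->; exact: partial_cst. Qed.

Definition coord_poly i (p : {poly R}) : V -> R := fun x => p.[x 0 i].

Lemma coord_shift i j (t : R) x : (t *: e j + x) 0 i = t * (i == j)%:R + x 0 i.
Proof. by rewrite !mxE eqxx /= eq_sym. Qed.

Lemma is_derive_coord_poly i (p : {poly R}) j x :
  is_derive x (e j) (coord_poly i p) ((i == j)%:R * p^`().[x 0 i]).
Proof.
have [->|neij] := eqVneq i j; last first.
  rewrite mul0r; split.
    apply/derivable1P; rewrite (_ : (fun _ => _) = cst p.[x 0 i]); last first.
      apply/funext => t; rewrite /coord_poly coord_shift (negPf neij).
      by rewrite mulr0 add0r.
    exact: derivable_cst.
  rewrite /derive; under eq_fun do
    rewrite /= /coord_poly coord_shift (negPf neij) mulr0 add0r subrr scaler0.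
  exact: lim_cst.
have H := is_derive_poly p (x 0 j).
rewrite mul1r; have E : (fun h : R => h^-1 *:
    (((coord_poly j p) \o shift x) (h *: e j) - coord_poly j p x)) =
  (fun h : R => h^-1 *: ((horner p \o shift (x 0 j)) (h *: 1) - p.[x 0 j])).
  apply/funext => h; rewrite /= /coord_poly coord_shift eqxx.
  by rewrite [h *: 1]mulr1 mulr1.
by split; [rewrite /derivable E|rewrite /derive E]; case: H.
Qed.

Lemma partial_coord_poly i j (p : {poly R}) :
  partial j (coord_poly i p) = coord_poly i ((i == j)%:R *: p^`()).
Proof.
apply/funext => x; have [_] := is_derive_coord_poly i p j x.
by rewrite /partial /coord_poly hornerZ => ->.
Qed.

Lemma smooth_coord_poly i p : smooth (coord_poly i p).
Proof.
apply: (@smooth_coind R d (fun f => exists p, f = coord_poly i p)); last first.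
  by exists p.
move=> _ [{}p ->]; split=> [x|j].
  apply: (@continuous_comp V R R (fun x => x 0 i) (horner p)).
    exact: coord_continuous.
  exact: continuous_horner.
split=> [x|]; first by case: (is_derive_coord_poly i p j x).
by eexists; exact: partial_coord_poly.
Qed.

(** The point [x] with its coordinate [i] replaced by [t] ([set_coordE]), written
    as a translation so that difference quotients can be computed on it. *)
Definition set_coord i (t : R) x : V := (t - x 0 i) *: e i + x.

Lemma set_coordE i t x j :
  set_coord i t x 0 j = if j == i then t else x 0 j.
Proof.
rewrite coord_shift; case: eqVneq => [->|_]; first by rewrite mulr1 subrK.
by rewrite mulr0 add0r.
Qed.

Lemma set_coord_shift_eq i t (r : R) x : set_coord i t (r *: e i + x) = set_coord i t x.
Proof.
apply/rowP => j; rewrite !set_coordE coord_shift.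
by case: eqVneq => // _; rewrite mulr0 add0r.
Qed.

Lemma set_coord_shift_neq i j t (r : R) x : i != j ->
  set_coord i t (r *: e j + x) = r *: e j + set_coord i t x.
Proof.
move=> neij; apply/rowP => l; rewrite set_coordE !(coord_shift _ j r) set_coordE.
by case: eqVneq => // ->; rewrite (negPf neij) mulr0 add0r.
Qed.

Lemma continuous_set_coord i t : continuous (set_coord i t).
Proof.
move=> x; have c1 : {for x, continuous (fun y : V => t - y 0 i)}.
  apply: (@continuousB R R V (cst t) (fun y : V => y 0 i) x).
    exact: cst_continuous.
  exact: coord_continuous.
have c2 := continuousZ c1 (@cst_continuous _ _ (e i) _).
exact: continuousD c2 (fun A HA => HA).
Qed.

Lemma partial_set_coord_neq i j t f : i != j ->
  partial j (f \o set_coord i t) = partial j f \o set_coord i t.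
Proof.
move=> neij; apply/funext => x; rewrite /partial /derive /=.
by under eq_fun do rewrite /= set_coord_shift_neq//.
Qed.

Lemma partial_set_coord_eq i t f : partial i (f \o set_coord i t) = cst 0.
Proof.
apply/funext => x; rewrite /partial /derive /=.
under eq_fun do rewrite /= set_coord_shift_eq subrr scaler0.
exact: lim_cst.
Qed.

Lemma smooth_set_coord i t f : smooth f -> smooth (f \o set_coord i t).
Proof.
move=> sf; apply: (@smooth_coind R d (fun g => exists2 f, smooth f &
  g = f \o set_coord i t)); last by exists f.
move=> _ [f1 sf1 ->]; split=> [x|j].
  apply: continuous_comp; first exact: continuous_set_coord.
  exact: smooth_continuous.
have [<-{j}|neij] := eqVneq i j; split=> [x|].
- rewrite /derivable; under eq_fun do
    rewrite /= set_coord_shift_eq subrr scaler0.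
  exact: is_cvg_cst.
- by exists (cst 0); [exact: smooth_cst|exact: partial_set_coord_eq].
- rewrite /derivable /=; under eq_fun do rewrite /= set_coord_shift_neq//.
  exact: (@smooth_derivable R d f1 j (set_coord i t x) sf1).
- exists (partial j f1); first exact: smooth_partial.
  exact: partial_set_coord_neq.
Qed.

Lemma iter_partial_set_coord i t s f : i \notin s ->
  iter_partial s (f \o set_coord i t) = iter_partial s f \o set_coord i t.
Proof.
elim: s => //= j s IH; rewrite inE negb_or => /andP[neij /IH ->].
by rewrite partial_set_coord_neq.
Qed.

Lemma mvt_partial f i x (t : R) : smooth f ->
  exists2 c, `|c| <= `|t| &
    f (t *: e i + x) - f x = partial i f (c *: e i + x) * t.
Proof.
move=> sf; pose F (r : R) := f (r *: e i + x).
have dF (r : R) : is_derive r 1 F (partial i f (r *: e i + x)).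
  have E : (fun h : R => h^-1 *: ((F \o shift r) (h *: 1) - F r)) =
    (fun h : R => h^-1 *: ((f \o shift (r *: e i + x)) (h *: e i)
                           - f (r *: e i + x))).
    apply/funext => h; rewrite /= /F.
    by rewrite [h *: 1]mulr1 scalerDl addrA.
  have H := @smooth_derivable R d f i (r *: e i + x) sf.
  by split; [rewrite /derivable E|rewrite /derive E].
have cF (a b : R) : {within `[a, b], continuous F}.
  by apply: derivable_within_continuous => r _; case: (dF r).
have F0 : F 0 = f x by rewrite /F scale0r add0r.
case: (leP 0 t) => t0.
  have [c ct] := MVT_segment t0 (fun r _ => dF r) (@cF _ _).
  rewrite F0 subr0 => E; exists c; last exact: E.
  by move: ct; rewrite in_itv/= => /andP[c0 ct]; rewrite !ger0_norm.
have [c ct] := MVT_segment (ltW t0) (fun r _ => dF r) (@cF _ _).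
rewrite F0 => E; exists c.
  move: ct; rewrite in_itv/= => /andP[ct c0].
  by rewrite ler0_norm// ltr0_norm// lerN2.
by apply: oppr_inj; rewrite opprB [LHS]E sub0r mulrN.
Qed.

End PartialDerivatives.

(** * Partial derivatives commute *)

Section Schwarz.
Variables (R : realType) (d : nat).
Local Notation V := 'rV[R]_d.
Local Notation e i := (delta_mx 0 i : V).
Implicit Types (f g : V -> R) (x y : V) (i j l : 'I_d) (s : seq 'I_d).

Lemma partial_translate i f (v : V) :
  partial i (fun y => f (v + y)) = fun y => partial i f (v + y).
Proof.
apply/funext => x; rewrite /partial /derive /=.
by under eq_fun do rewrite /= addrCA.
Qed.

Lemma smooth_translate f (v : V) : smooth f -> smooth (fun y => f (v + y)).
Proof.
move=> sf; apply: (@smooth_coind _ _ (fun g => exists2 f, smooth f &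
  g = fun y => f (v + y))); last by exists f.
move=> _ [g sg ->]; split=> [x|i].
  have c1 := continuousD (@cst_continuous _ _ v _)
    ((fun A HA => HA) : {for x, continuous (fun y : V => y)}).
  exact: (@continuous_comp _ _ _ (fun y => v + y) g x c1
    (@smooth_continuous _ _ _ sg _)).
split=> [x|].
  rewrite /derivable /=; under eq_fun do rewrite addrCA.
  exact: (@smooth_derivable _ _ g i (v + x) sg).
exists (partial i g); first exact: smooth_partial.
exact: partial_translate.
Qed.

(** The mean value theorem applied first in the direction [i] to the increment
    of [f] along [t *: e j], then in the direction [j]. *)
Lemma second_difference i j f x (t : R) : smooth f ->
  exists a b, [/\ `|a| <= `|t|, `|b| <= `|t| &
    f (t *: e j + (t *: e i + x)) - f (t *: e i + x) - (f (t *: e j + x) - f x)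
    = partial j (partial i f) (b *: e j + (a *: e i + x)) * t * t].
Proof.
move=> sf; pose g := (fun y => f (t *: e j + y)) - f.
have sg : smooth g by exact: smoothB (smooth_translate _ sf) sf.
have [a at_ E] := mvt_partial i x t sg.
have [b bt E'] := mvt_partial j (a *: e i + x) t (smooth_partial i sf).
exists a, b; split=> //; rewrite -E' [LHS]E /g; congr (_ * _).
have := iter_partialB [:: i] (smooth_translate (t *: e j) sf) sf.
by rewrite /= => ->; rewrite partial_translate.
Qed.

(** Up to the order of the terms, the second difference is symmetric in [i] and
    [j], so the two mixed derivatives agree at two points that are arbitrarily
    close to [x]; both are continuous at [x]. *)
Lemma schwarz i j f : smooth f ->
  partial i (partial j f) = partial j (partial i f).
Proof.
move=> sf; apply/funext => x; apply/eqP; rewrite -subr_eq0 -normr_eq0.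
set F := partial i _; set G := partial j _.
rewrite eq_le normr_ge0 andbT leNgt; apply/negP => D0.
pose D := `|F x - G x|.
have near_val (H : V -> R) : smooth H ->
    exists2 r : R, 0 < r & forall y, `|y| < r -> `|H x - H (y + x)| < D / 2.
  move=> /smooth_continuous /(_ x) /cvgrPdist_lt /(_ (D / 2)).
  rewrite divr_gt0// => /(_ isT) /nbhs_ballP[r /= r0 Hr].
  exists r => // y yr; apply: Hr; rewrite -ball_normE /= opprD addrCA.
  by rewrite subrr addr0 normrN.
have [r1 r10 near1] := near_val F (smooth_partial i (smooth_partial j sf)).
have [r2 r20 near2] := near_val G (smooth_partial j (smooth_partial i sf)).
(* [t] is so small that a combination of [e i] and [e j] with coefficients at
   most [t] has norm less than [r1] and [r2]. *)
pose c : R := `|e i| + `|e j| + 1.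
have c0 : 0 < c by rewrite ltr_wpDl// addr_ge0.
pose t := Num.min r1 r2 / c.
have t0 : 0 < t by rewrite divr_gt0// lt_min r10.
have small (a b : R) k l : `|a| <= `|t| -> `|b| <= `|t| ->
    `|e k| + `|e l| < c -> `|b *: e l + a *: e k| < Num.min r1 r2.
  move=> at_ bt kl; rewrite (le_lt_trans (ler_normD _ _))// !normrZ.
  rewrite (@le_lt_trans _ _ (t * (`|e l| + `|e k|)))//.
    by rewrite mulrDr lerD// ler_wpM2r// -[leRHS]gtr0_norm.
  by rewrite addrC -ltr_pdivlMl// mulrC /t invf_div mulrCA divff ?mulr1//
    gt_eqF// lt_min r10.
have ijc : `|e i| + `|e j| < c by rewrite ltrDl.
have [a [b [ha hb E]]] := second_difference i j x t sf.
have [a' [b' [ha' hb' E']]] := second_difference j i x t sf.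
have FG : G (b *: e j + (a *: e i + x)) = F (b' *: e i + (a' *: e j + x)).
  apply: (mulIf (lt0r_neq0 t0)); apply: (mulIf (lt0r_neq0 t0)).
  apply: etrans (esym E) _; apply: etrans _ E'.
  rewrite (addrCA (t *: e j)); move: (f _) (f _) (f _) => A B C.
  by rewrite opprB opprB addrACA (addrC (- B)) addrACA.
have := near1 (b' *: e i + a' *: e j); have := near2 (b *: e j + a *: e i).
rewrite -(addrA (b *: e j)) -(addrA (b' *: e i)) -FG.
have -> : `|b *: e j + a *: e i| < r2.
  by apply: lt_le_trans (small _ _ _ _ ha hb ijc) _; rewrite ge_min lexx orbT.
have -> : `|b' *: e i + a' *: e j| < r1.
  apply: lt_le_trans (small _ _ _ _ ha' hb' _) _; first by rewrite addrC.
  by rewrite ge_min lexx.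
move=> /(_ isT) h2 /(_ isT) h1.
have : D < D / 2 + D / 2.
  rewrite distrC in h2.
  exact: le_lt_trans (ler_distD _ _ _) (ltrD h1 h2).
by rewrite -splitr ltxx.
Qed.

Lemma iter_partial_partial s i f : smooth f ->
  iter_partial s (partial i f) = partial i (iter_partial s f).
Proof.
move=> sf; elim: s => //= j s ->.
by apply: schwarz; exact: smooth_iter_partial.
Qed.

Lemma iter_partial_rem s i f : smooth f -> i \in s ->
  iter_partial s f = iter_partial (rem i s) (partial i f).
Proof.
move=> sf; elim: s => //= j s IH; rewrite inE.
have [->|neij] /= := eqVneq j i; first by rewrite iter_partial_partial.
by move=> /IH ->.
Qed.

End Schwarz.

(** * C^n bounds on cubes *)

Section CnBounds.
Variables (R : realType) (d : nat).
Local Notation V := 'rV[R]_d.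
Implicit Types (f g u : V -> R) (x y : V) (i j l : 'I_d) (s : seq 'I_d).
Implicit Types (n : nat) (L a b : R).

Definition cube L : set V := [set x | forall i, `|x 0 i| <= L].

(** Here [a] bounds the C^n norm of [f] on the cube of half side [L]. *)
Definition Cn_le n L a f :=
  forall s, (size s <= n)%N -> forall x, cube L x -> `|iter_partial s f x| <= a.

Lemma continuous_bounded_cube L f : continuous f ->
  exists2 C, 0 <= C & forall x, cube L x -> `|f x| <= C.
Proof.
move=> cf; have cube_compact : compact (cube L).
  have := @rV_compact R d (fun=> `[(- L), L]%classic) (fun=> @segment_compact _ _ _).
  congr compact; apply/seteqP; split=> x /= xL i; have := xL i.
    by rewrite in_itv/= ler_norml.
  by rewrite in_itv/= ler_norml.
have := @continuous_compact _ _ f (cube L)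
  (continuous_subspaceT cf) cube_compact.
move=> /compact_bounded[M [Mr HM]]; exists `|M + 1| => // x Lx.
apply: le_trans (ler_norm _); apply: (HM (M + 1)); first by rewrite ltrDl.
by exists x.
Qed.

Lemma Cn_le0P L a f : (forall x, cube L x -> `|f x| <= a) -> Cn_le 0 L a f.
Proof. by move=> fa [|//] _ x; exact: fa. Qed.

Lemma Cn_leSP n L a f : (forall x, cube L x -> `|f x| <= a) ->
  (forall i, Cn_le n L a (partial i f)) -> Cn_le n.+1 L a f.
Proof.
move=> fa dfa; elim/last_ind=> [_ x|s i _]; first exact: fa.
by rewrite size_rcons iter_partial_rcons; exact: dfa.
Qed.

Lemma Cn_le_val n L a f x : Cn_le n L a f -> cube L x -> `|f x| <= a.
Proof. by move=> /(_ [::] isT); exact. Qed.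

Lemma Cn_le_partial n L a f i : Cn_le n.+1 L a f -> Cn_le n L a (partial i f).
Proof.
by move=> fa s sn; rewrite -iter_partial_rcons; apply: fa; rewrite size_rcons.
Qed.

Lemma Cn_leW n m L a b f : (m <= n)%N -> a <= b ->
  Cn_le n L a f -> Cn_le m L b f.
Proof.
move=> mn ab fa s sm x Lx.
by apply: le_trans ab; apply: fa => //; exact: leq_trans mn.
Qed.

Lemma Cn_leD n L a b f g : smooth f -> smooth g ->
  Cn_le n L a f -> Cn_le n L b g -> Cn_le n L (a + b) (f + g).
Proof.
move=> sf sg fa gb s sn x Lx; rewrite (iter_partialD s sf sg).
exact: le_trans (ler_normD _ _) (lerD (fa s sn x Lx) (gb s sn x Lx)).
Qed.

Lemma smooth_Cn_le n L f : smooth f -> exists2 a, 0 <= a & Cn_le n L a f.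
Proof.
elim: n f => [|n IH] f sf.
  have [C C0 fC] := continuous_bounded_cube L (smooth_continuous sf).
  by exists C => //; exact: Cn_le0P.
have [C C0 fC] := continuous_bounded_cube L (smooth_continuous sf).
have /choice[c Hc] : forall i, exists a, 0 <= a /\ Cn_le n L a (partial i f).
  by move=> i; have [a] := IH _ (smooth_partial i sf); exists a.
have c0 : 0 <= \sum_i c i by apply: sumr_ge0 => i _; case: (Hc i).
exists (C + \sum_i c i); first by rewrite addr_ge0.
apply: Cn_leSP => [x /fC H|i]; first by rewrite (le_trans H)// lerDl.
apply: Cn_leW (Hc i).2 => //; rewrite ler_wpDl// (bigD1 i)//= lerDl.
by apply: sumr_ge0 => j _; case: (Hc j).
Qed.

(** Continuity of the multiplication by [u] for the C^n norm: the induction on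
    [n] uses the Leibniz rule once and the statement for [u] and for its partial
    derivatives. *)
Lemma Cn_leM n L u : smooth u -> exists2 C, 0 <= C &
  forall f a, smooth f -> 0 <= a -> Cn_le n L a f -> Cn_le n L (C * a) (u * f).
Proof.
elim: n u => [|n IH] u su;
  have [C C0 uC] := continuous_bounded_cube L (smooth_continuous su).
  exists C => // f a sf a0 fa; apply: Cn_le0P => x Lx.
  rewrite [_ x]/(u x * f x) normrM ler_pM//; first exact: uC.
  exact: Cn_le_val fa Lx.
have [C1 C10 uC1] := IH _ su.
have /choice[c Hc] : forall i, exists C, 0 <= C /\ forall f a, smooth f ->
    0 <= a -> Cn_le n L a f -> Cn_le n L (C * a) (partial i u * f).
  by move=> i; have [a a0 Ha] := IH _ (smooth_partial i su); exists a.
have c0 : 0 <= \sum_i c i by apply: sumr_ge0 => i _; case: (Hc i).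
exists (C + (C1 + \sum_i c i)); first by rewrite !addr_ge0.
move=> f a sf a0 fa; apply: Cn_leSP => [x Lx|i].
  rewrite [_ x]/(u x * f x) normrM ler_pM//; last exact: Cn_le_val fa Lx.
  by rewrite (le_trans (uC _ Lx))// lerDl addr_ge0.
rewrite (partialM i su sf).
have sm1 := smoothM su (smooth_partial i sf).
have sm2 := smoothM (smooth_partial i su) sf.
have fa' : Cn_le n L a f by exact: Cn_leW fa.
have := Cn_leD sm1 sm2 (uC1 _ _ (smooth_partial i sf) a0 (Cn_le_partial i fa))
  ((Hc i).2 _ _ sf a0 fa').
apply: Cn_leW => //; rewrite -mulrDl ler_wpM2r// ler_wpDl// lerD2l.
by rewrite (bigD1 i)//= lerDl; apply: sumr_ge0 => j _; case: (Hc j).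
Qed.

End CnBounds.

(** * Limits of rational polynomials *)

Section RationalPolynomials.
Variables (R : realType) (d : nat).
Local Notation V := 'rV[R]_d.
Implicit Types (f g u : V -> R) (x y : V) (i j l : 'I_d) (s : seq 'I_d).
Implicit Types (p q : mpoly.mpoly d rat).
Local Notation ratfun := (@rat_mpoly_fun R d).

Lemma rat_mpoly_funD p q :
  ratfun (p + q) = ratfun p + ratfun q.
Proof. by apply/funext => x; rewrite /rat_mpoly_fun raddfD/= mevalD. Qed.

Lemma rat_mpoly_funM p q :
  ratfun (p * q) = ratfun p * ratfun q.
Proof. by apply/funext => x; rewrite /rat_mpoly_fun rmorphM/= mevalM. Qed.

Lemma rat_mpoly_funC (c : rat) :
  ratfun (mpolyC d c) = cst (ratr c).
Proof. by apply/funext => x; rewrite /rat_mpoly_fun map_mpolyC mevalC. Qed.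

Lemma rat_mpoly_funX i :
  ratfun (mpolyX rat (mnm1 i)) = coord_poly i 'X.
Proof.
by apply/funext => x; rewrite /rat_mpoly_fun map_mpolyX mevalXU /coord_poly hornerX.
Qed.

Lemma coord_poly_rat i (phi : {poly rat}) :
  exists p, ratfun p = coord_poly i (map_poly ratr phi).
Proof.
elim/poly_ind: phi => [|phi c [p IH]].
  exists (mpolyC d 0); rewrite rat_mpoly_funC; apply/funext => x.
  by rewrite /coord_poly !rmorph0 horner0.
exists (p * mpolyX rat (mnm1 i) + mpolyC d c).
rewrite rat_mpoly_funD rat_mpoly_funM rat_mpoly_funC rat_mpoly_funX IH.
apply/funext => x.
rewrite [LHS]/(coord_poly i (map_poly ratr phi) x * coord_poly i 'X x + ratr c).
by rewrite /coord_poly rmorphD rmorphM/= map_polyX map_polyC/= !hornerE.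
Qed.

(** Smoothness of the approximating polynomial is carried along, because the
    derivatives of [f - rat_mpoly_fun p] split only for smooth functions. *)
Definition approximable f := forall n (L eps : R), 0 < eps ->
  exists2 p, smooth (ratfun p) & Cn_le n L eps (f - ratfun p).

Lemma approximable_lim f : smooth f ->
  (forall n (L eps : R), 0 < eps -> exists g, [/\ smooth g, approximable g
     & Cn_le n L eps (f - g)]) ->
  approximable f.
Proof.
move=> sf fg n L eps e0; have e20 : 0 < eps / 2 by rewrite divr_gt0.
have [g [sg ag fgn]] := fg n L _ e20.
have [p sp gp] := ag n L _ e20; exists p => //.
have := Cn_leD (smoothB sf sg) (smoothB sg sp) fgn gp.
by rewrite -splitr subrKA.
Qed.

Lemma approximable_cst (c : R) : approximable (cst c).
Proof.
move=> n L eps e0; have [q] := @rat_in_itvoo R (c - eps) c ltac:(by rewrite gtrBl).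
rewrite in_itv/= => /andP[cq qc]; exists (mpolyC d q).
  by rewrite rat_mpoly_funC; exact: smooth_cst.
rewrite rat_mpoly_funC; rewrite (_ : _ - _ = cst (c - ratr q)); last first.
  by apply/funext.
elim: n => [|n IH]; [apply: Cn_le0P => x _|apply: Cn_leSP => [x _|i]].
- by rewrite /= gtr0_norm ?subr_gt0// lerBlDl -lerBlDr ltW.
- by rewrite /= gtr0_norm ?subr_gt0// lerBlDl -lerBlDr ltW.
rewrite partial_cst => s _ x _.
by rewrite [cst 0]/(0 : V -> R) iter_partial0 normr0 ltW.
Qed.

Lemma approximableD f g : smooth f -> smooth g ->
  approximable f -> approximable g -> approximable (f + g).
Proof.
move=> sf sg af ag n L eps e0; have e20 : 0 < eps / 2 by rewrite divr_gt0.
have [p sp fp] := af n L _ e20; have [q sq gq] := ag n L _ e20.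
exists (p + q); rewrite rat_mpoly_funD; first exact: smoothD.
have := Cn_leD (smoothB sf sp) (smoothB sg sq) fp gq.
by rewrite -splitr opprD addrACA.
Qed.

(** The factor has rational coefficients, so it is itself a rational polynomial
    and multiplies the approximants of [f]; [Cn_leM] controls the error. *)
Lemma approximable_coord_poly i (phi : {poly rat}) f : smooth f ->
  approximable f -> approximable (coord_poly i (map_poly ratr phi) * f).
Proof.
move=> sf af n L eps e0.
have su : smooth (coord_poly i (map_poly ratr phi) : V -> R).
  exact: smooth_coord_poly.
have [C C0 uC] := Cn_leM n L su.
have d0 : 0 < eps / (C + 1) by rewrite divr_gt0// ltr_wpDl.
have [p sp fp] := af n L _ d0; have [q qE] := coord_poly_rat i phi.
exists (q * p); rewrite rat_mpoly_funM qE; first exact: smoothM.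
rewrite -mulrBr; apply: Cn_leW (uC _ _ (smoothB sf sp) (ltW d0) fp) => //.
by rewrite mulrCA ler_piMr ?ltW// ltr_pdivrMr ?mul1r ?ltrDl// ltr_wpDl.
Qed.

End RationalPolynomials.

(** * Bernstein polynomials with rational coefficients *)

Section BernsteinKernel.

(** The Bernstein polynomials ['C(n, k) u^k (1 - u)^(n - k)], defined by
    Pascal's rule: they are evaluated below at polynomials as well as at numbers,
    and the recursion gives their moments by induction. *)
Fixpoint bern (A : comPzRingType) (u : A) (n k : nat) : A :=
  if n is n'.+1 then
    (1 - u) * bern u n' k + (if k is k'.+1 then u * bern u n' k' else 0)
  else (k == 0)%:R.

Lemma bern_small (A : comPzRingType) (u : A) n k : (n < k)%N -> bern u n k = 0.
Proof.
elim: n k => [[]//|n IH] [//|k] nk /=.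
by rewrite !IH ?mulr0 ?addr0// ltnW.
Qed.

Lemma bern_morph (A B : comPzRingType) (phi : {rmorphism A -> B}) u n k :
  phi (bern u n k) = bern (phi u) n k.
Proof.
elim: n k => [|n IH] k /=; first by rewrite rmorph_nat.
rewrite rmorphD rmorphM rmorphB rmorph1 IH; congr (_ + _).
by case: k => [|k]; rewrite ?rmorph0// rmorphM IH.
Qed.

Lemma bern_ge0 (R : realDomainType) (u : R) n k : 0 <= u <= 1 ->
  0 <= bern u n k.
Proof.
move=> /andP[u0 u1]; elim: n k => [|n IH] k /=; first exact: ler0n.
rewrite addr_ge0// ?mulr_ge0 ?subr_ge0//.
by case: k => // k; rewrite mulr_ge0.
Qed.

(** One more Bernoulli trial of success probability [u]. *)
Lemma bern_sumS (A : comPzRingType) (u : A) n (g : nat -> A) :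
  \sum_(k < n.+2) bern u n.+1 k * g k =
  \sum_(k < n.+1) bern u n k * ((1 - u) * g k + u * g k.+1).
Proof.
under eq_bigr do rewrite /= mulrDl.
rewrite big_split/= big_ord_recr/= bern_small// mulr0 mul0r addr0.
rewrite [X in _ + X]big_ord_recl/= mul0r add0r -big_split/=.
by apply: eq_bigr => k _; rewrite mulrDr !mulrA ![bern _ _ _ * _]mulrC.
Qed.

Lemma bern_sum1 (A : comPzRingType) (u : A) n : \sum_(k < n.+1) bern u n k = 1.
Proof.
under eq_bigr do rewrite -[bern _ _ _]mulr1.
elim: n => [|n IH]; first by rewrite big_ord1/= mulr1.
rewrite (bern_sumS u n (fun=> 1)) -[RHS]IH.
by apply: eq_bigr => k _; rewrite !mulr1 subrK mulr1.
Qed.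

(** Variance plus squared bias of a binomial variable as an estimator of [c];
    leaving [c] free makes the induction go through, since one more trial
    replaces [c] by [c - u] and adds the variance of a single trial. *)
Lemma bern_variance (A : comPzRingType) (u c : A) n :
  \sum_(k < n.+1) bern u n k * (k%:R - c) ^+ 2 =
  n%:R * (u * (1 - u)) + (n%:R * u - c) ^+ 2.
Proof.
elim: n c => [|n IH] c; first by rewrite big_ord1/=; ring.
rewrite (bern_sumS u n (fun k => (k%:R - c) ^+ 2)).
rewrite (eq_bigr (fun k : 'I_n.+1 => bern u n k * (k%:R - (c - u)) ^+ 2 +
  bern u n k * (u * (1 - u)))) => [|k _]; last by rewrite -natr1; ring.
by rewrite big_split/= IH -mulr_suml bern_sum1 -natr1; ring.
Qed.

(** Bernstein polynomials rescaled to the interval from [- m] to [m]: weights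
    with rational coefficients, supported on nodes [t k], whose mean distance to
    [x] is small uniformly in [x]. The mean distance is bounded by the variance
    through [|w| <= eps / 2 + w^2 / (2 * eps)]. *)
Lemma bernstein_kernel (R : realType) (m : nat) (eps : R) :
  (0 < m)%N -> 0 < eps ->
  exists (N : nat) (phi : nat -> {poly rat}) (t : nat -> R),
    (forall k, (k < N)%N -> `|t k| <= m%:R) /\
    forall x : R, `|x| <= m%:R ->
      [/\ forall k, 0 <= (map_poly ratr (phi k)).[x],
          \sum_(k < N) (map_poly ratr (phi k)).[x] = 1
        & \sum_(k < N) (map_poly ratr (phi k)).[x] * `|t k - x| <= eps].
Proof.
move=> m0 eps0; have mR : 0 < m%:R :> R by rewrite ltr0n.
(* With this [n], both halves of the bound on the mean distance are at most
   [eps / 2]. *)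
pose n := (Num.bound (4 * m%:R ^+ 2 / eps ^+ 2 : R)).
have nP : 4 * m%:R ^+ 2 / eps ^+ 2 < n%:R :> R.
  by apply: archi_boundP; rewrite divr_ge0 ?mulr_ge0 ?exprn_ge0 ?ltW.
have n0 : 0 < n%:R :> R.
  by apply: le_lt_trans nP; rewrite divr_ge0 ?mulr_ge0 ?exprn_ge0 ?ltW.
pose U : {poly rat} := (2 * m%:R)^-1 *: ('X + m%:R%:P).
exists n.+1, (bern U n), (fun k => 2 * m%:R * k%:R / n%:R - m%:R).
split=> [k kn|x xm].
  have t0 : 0 <= 2 * m%:R * k%:R / n%:R :> R by rewrite divr_ge0 ?mulr_ge0.
  have t1 : 2 * m%:R * k%:R / n%:R <= 2 * m%:R :> R.
    by rewrite ler_pdivrMr// ler_wpM2l ?mulr_ge0// ler_nat.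
  by rewrite ler_norml; apply/andP; split; lra.
pose u : R := (x + m%:R) / (2 * m%:R).
have bE k : (map_poly ratr (bern U n k)).[x] = bern u n k.
  have -> := bern_morph (map_poly (ratr : rat -> R)) U n k.
  apply: etrans (bern_morph (horner_eval x) (map_poly ratr U) n k) _.
  congr bern; rewrite /U map_polyZ/= rmorphD/= map_polyX map_polyC/=.
  rewrite horner_evalE hornerZ hornerD hornerX hornerC.
  by rewrite fmorphV rmorphM/= !rmorph_nat mulrC.
have u01 : 0 <= u <= 1.
  move: xm; rewrite ler_norml => /andP[x1 x2]; rewrite /u divr_ge0 ?mulr_ge0//.
    by rewrite ler_pdivrMr ?mulr_gt0// mul1r; lra.
  by rewrite -lerBlDr sub0r.
split=> [k||]; first by rewrite bE bern_ge0.
  by under eq_bigr do rewrite bE; exact: bern_sum1.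
under eq_bigr do rewrite bE.
have xE : x = 2 * m%:R * u - m%:R by rewrite /u; field; rewrite gt_eqF.
have H (k : 'I_n.+1) : bern u n k * `|2 * m%:R * k%:R / n%:R - m%:R - x| <=
    bern u n k * (eps / 2) +
    bern u n k * (k%:R - n%:R * u) ^+ 2 * (2 * m%:R ^+ 2 / (eps * n%:R ^+ 2)).
  rewrite -(mulrA (bern u n k)) -mulrDr ler_wpM2l ?bern_ge0//.
  set w := _ - x; have -> : (k%:R - n%:R * u) ^+ 2 *
      (2 * m%:R ^+ 2 / (eps * n%:R ^+ 2)) = `|w| ^+ 2 / (2 * eps).
    rewrite real_normK ?num_real// /w xE; field.
    by rewrite !gt_eqF.
  rewrite -subr_ge0.
  have -> : eps / 2 + `|w| ^+ 2 / (2 * eps) - `|w| = (`|w| - eps) ^+ 2 / (2 * eps).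
    by field; rewrite gt_eqF.
  by rewrite divr_ge0 ?sqr_ge0// mulr_ge0// ltW.
apply: le_trans (ler_sum _ (fun k _ => H k)) _.
rewrite big_split/= -mulr_suml bern_sum1 mul1r -mulr_suml bern_variance.
rewrite subrr expr0n/= addr0 [leRHS]splitr lerD2l.
have -> : n%:R * (u * (1 - u)) * (2 * m%:R ^+ 2 / (eps * n%:R ^+ 2)) =
    (4 * m%:R ^+ 2 / eps ^+ 2) / n%:R * (u * (1 - u)) * (eps / 2).
  by field; rewrite !gt_eqF.
apply: ler_piMl; first by rewrite divr_ge0 ?(ltW eps0).
move: u01 => /andP[u0 u1]; rewrite mulr_ile1//.
- by rewrite !divr_ge0 ?mulr_ge0 ?exprn_ge0 ?(ltW eps0).
- by rewrite mulr_ge0// subr_ge0.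
- by rewrite ler_pdivrMr// mul1r ltW.
- by rewrite mulr_ile1// ?subr_ge0// lerBlDr lerDl.
Qed.

End BernsteinKernel.

(** * Approximation in one coordinate *)

Section OneCoordinate.
Variables (R : realType) (d : nat).
Local Notation V := 'rV[R]_d.
Local Notation e i := (delta_mx 0 i : V).
Implicit Types (f g h : V -> R) (x y : V) (i j l : 'I_d) (s : seq 'I_d).

Definition depends_lt (k : nat) f := forall x y,
  (forall j : 'I_d, (j < k)%N -> x 0 j = y 0 j) -> f x = f y.

Lemma depends_lt_partial k i f : depends_lt k f -> depends_lt k (partial i f).
Proof.
move=> fk x y xy; rewrite /partial /derive.
suff -> : (fun r : R => r^-1 *: ((f \o shift x) (r *: e i) - f x)) =
          (fun r : R => r^-1 *: ((f \o shift y) (r *: e i) - f y)) by [].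
apply/funext => r /=; rewrite (fk _ _ xy); congr (_ *: (_ - _)).
by apply: fk => j jk; rewrite !coord_shift xy.
Qed.

Lemma depends_lt_set_coord i t f : depends_lt i.+1 f ->
  depends_lt i (f \o set_coord i t).
Proof.
move=> fi x y xy; apply: fi => j ji; rewrite !set_coordE.
by case: eqVneq => // neji; apply: xy; rewrite ltn_neqAle -ltnS ji andbT.
Qed.

Local Notation ratpoly i phi := (coord_poly i (map_poly ratr phi)).

(** Finite sums of terms [phi(x_i) * h(x)], with [phi] a rational polynomial and
    [h] smooth and a function of the coordinates below [i] only. *)
Inductive separated i : (V -> R) -> Prop :=
| separated0 : separated i 0
| separatedD (phi : {poly rat}) h g of smooth h & depends_lt i h &
    separated i g : separated i (ratpoly i phi * h + g).

Lemma separated_smooth i g : separated i g -> smooth g.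
Proof.
elim=> [|phi h {}g sh _ _ sg]; first exact: (@smooth_cst _ _ 0).
exact: smoothD (smoothM (@smooth_coord_poly _ _ _ _) sh) sg.
Qed.

Lemma separated_sum i N (phi : nat -> {poly rat}) (h : nat -> V -> R) :
  (forall k, smooth (h k)) -> (forall k, depends_lt i (h k)) ->
  separated i (\sum_(k < N) ratpoly i (phi k) * h k).
Proof.
move=> sh dh; elim/big_rec: _ => [|k g _ sg]; first exact: separated0.
exact: separatedD (sh k) (dh k) sg.
Qed.

Lemma partial_coord_polyM i (p : {poly R}) h : smooth h ->
  depends_lt i h ->
  partial i (coord_poly i p * h) = coord_poly i p^`() * h.
Proof.
move=> sh dh; rewrite (partialM i (@smooth_coord_poly _ _ i p) sh).
rewrite partial_coord_poly eqxx scale1r.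
have -> : partial i h = 0.
  rewrite (_ : h = h \o set_coord i 0) ?partial_set_coord_eq//.
  apply/funext => x; apply: dh => j ji; rewrite set_coordE.
  by case: eqVneq => // ji'; rewrite ji' ltnn in ji.
by rewrite mulr0 add0r.
Qed.

Lemma exists_antiderivative (phi : {poly rat}) :
  exists2 Phi : {poly rat}, Phi^`() = phi & Phi.[0] = 0.
Proof.
exists (\poly_(k < (size phi).+1) (phi`_k.-1 / k%:R * (k != 0)%:R)).
  apply/polyP => k; rewrite coef_deriv coef_poly ltnS.
  case: ltnP => [_|/leq_sizeP/(_ k (leqnn k))->]; last by rewrite mul0rn.
  by rewrite mulr1 -[LHS]mulr_natr divfK// pnatr_eq0.
by rewrite horner_coef0 coef_poly/= mulr0.
Qed.

(** The coefficients [h] are constants for the differentiation in the direction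
    [i], so it suffices to integrate the polynomials [phi]. *)
Lemma separated_antiderivative i g : separated i g ->
  exists G, [/\ separated i G, partial i G = g &
    forall x, G (set_coord i 0 x) = 0].
Proof.
elim=> [|phi h {}g sh dh _ [G [sG GE G0]]].
  by exists 0; split=> //; [exact: separated0|exact: partial_cst].
have [Phi PhiE Phi0] := exists_antiderivative phi.
exists (ratpoly i Phi * h + G); split=> [||x].
- exact: separatedD.
- rewrite (partialD i (smoothM (@smooth_coord_poly _ _ _ _) sh)
    (separated_smooth sG)) GE partial_coord_polyM//.
  by rewrite deriv_map PhiE.
have P0 : coord_poly i (map_poly ratr Phi) (set_coord i 0 x) = 0 :> R.
  rewrite /coord_poly set_coordE eqxx -(rmorph0 (ratr : rat -> R)).
  by rewrite horner_map/= Phi0.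
have E := congr1 (fun a => a * h (set_coord i 0 x)) P0.
by apply: etrans (congr2 +%R E (G0 x)) _; rewrite mul0r addr0.
Qed.

Lemma iter_partial_coord_polyM i (p : {poly R}) s h : smooth h -> i \notin s ->
  iter_partial s (coord_poly i p * h) = coord_poly i p * iter_partial s h.
Proof.
move=> sh; elim: s => //= j s IH; rewrite inE negb_or => /andP[neij /IH ->].
rewrite (partialM j (@smooth_coord_poly _ _ i p) (smooth_iter_partial s sh)).
rewrite partial_coord_poly (negPf neij) scale0r.
rewrite (_ : coord_poly i 0 = 0) ?mul0r ?addr0//.
by apply/funext => x; rewrite /coord_poly horner0.
Qed.

Lemma iter_partial_sum s N (F : nat -> V -> R) : (forall k, smooth (F k)) ->
  iter_partial s (\sum_(k < N) F k) = \sum_(k < N) iter_partial s (F k).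
Proof.
move=> sF; suff [] : smooth (\sum_(k < N) F k) /\
  iter_partial s (\sum_(k < N) F k) = \sum_(k < N) iter_partial s (F k) by [].
elim: N => [|N [IH1 IH2]]; first by rewrite !big_ord0 iter_partial0; split;
  [exact: (@smooth_cst _ _ 0)|].
rewrite !big_ord_recr/= (iter_partialD s IH1 (sF N)) IH2.
split; [exact: smoothD IH1 (sF N)|by []].
Qed.

(** The Bernstein operator in the variable [x_i] commutes with the derivatives
    in the other variables, so the error on such a derivative [F] of [f] is a
    mean of differences of [F] between [x] and nodes on the line through [x] in
    the direction [i], at most [C] times their mean distance to [x]. *)
Lemma separated_approx0 i n (m : nat) f (eps : R) : (0 < m)%N ->
  smooth f -> depends_lt i.+1 f -> 0 < eps ->
  exists2 g, separated i g & forall s, (size s <= n)%N -> i \notin s ->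
    forall x, cube m%:R x -> `|iter_partial s (f - g) x| <= eps.
Proof.
move=> m0 sf df e0.
(* The mean value theorem moves from [x_i] to a node by at most [2 * m], hence
   the cube of half side [3 * m]. *)
have [C C0 fC] := smooth_Cn_le n.+1 (3 * m%:R) sf.
have e'0 : 0 < eps / (C + 1) by rewrite divr_gt0// ltr_wpDl.
have [N [phi [t [tm phiP]]]] := bernstein_kernel m0 e'0.
pose h k := f \o set_coord i (t k).
have sh k : smooth (h k) by exact: smooth_set_coord.
have dh k : depends_lt i (h k) by exact: depends_lt_set_coord.
have sg := separated_sum N phi sh dh.
exists (\sum_(k < N) ratpoly i (phi k) * h k) => // s sn nis x xm.
rewrite (iter_partialB s sf (separated_smooth sg)).
set F := iter_partial s f.
have -> : iter_partial s (\sum_(k < N) ratpoly i (phi k) * h k) =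
    \sum_(k < N) ratpoly i (phi k) * (F \o set_coord i (t k)).
  have sG k : smooth (ratpoly i (phi k) * h k).
    exact: smoothM (@smooth_coord_poly _ _ _ _) (sh k).
  rewrite (iter_partial_sum s N sG); apply: eq_bigr => k _.
  rewrite (iter_partial_coord_polyM _ (sh k) nis).
  by rewrite (iter_partial_set_coord _ _ nis).
have [phi0 phi1 phiE] := phiP (x 0 i) (xm i).
have -> : (F - \sum_(k < N) ratpoly i (phi k) * (F \o set_coord i (t k))) x =
  \sum_(k < N) (map_poly ratr (phi k)).[x 0 i] *
     (F x - F (set_coord i (t k) x)).
  under [RHS]eq_bigr do rewrite mulrBr.
  by rewrite sumrB -mulr_suml phi1 mul1r [LHS]/(_ - _) fct_sumE.
have key (k : 'I_N) : `|F x - F (set_coord i (t k) x)| <= C * `|t k - x 0 i|.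
  have [c ct E] := mvt_partial i x (t k - x 0 i) (smooth_iter_partial s sf).
  rewrite distrC [X in `|X|]E normrM ler_wpM2r//.
  apply: (fC (i :: s)) => // j; rewrite coord_shift.
  rewrite (le_trans (ler_normD _ _))// normrM.
  have c2m : `|c| <= 2 * m%:R.
    rewrite (le_trans ct)// (le_trans (ler_normB _ _))// mulrDl mul1r lerD//.
    exact: tm.
  rewrite (_ : 3 * m%:R = 2 * m%:R + m%:R :> R); last by ring.
  rewrite lerD// (le_trans _ c2m)// ler_piMr//.
  by case: eqVneq; rewrite ?normr1 ?normr0.
apply: le_trans (ler_norm_sum _ _ _) _.
apply: (@le_trans _ _ (\sum_(k < N) C *
    ((map_poly ratr (phi k)).[x 0 i] * `|t k - x 0 i|))).
  apply: ler_sum => k _; rewrite normrM ger0_norm// mulrCA ler_wpM2l//.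
rewrite -mulr_sumr (le_trans (ler_wpM2l C0 phiE))//.
by rewrite mulrCA ler_piMr ?(ltW e0)// ltW// ltr_pdivrMr ?mul1r ?ltrDl// ltr_wpDl.
Qed.

End OneCoordinate.

(** * Approximation in all coordinates *)

Section RationalApproximation.
Variables (R : realType) (d : nat).
Local Notation V := 'rV[R]_d.
Local Notation e i := (delta_mx 0 i : V).
Implicit Types (f g h : V -> R) (x y : V) (i j l : 'I_d) (s : seq 'I_d).

(** Induction on the number [M] of derivatives in the direction [i] that are
    controlled. The approximant of [f] is [f0 + G], where [f0] is [f] restricted
    to [x_i = 0] and [G] is the antiderivative, zero on [x_i = 0], of an
    approximant of the partial derivative of [f] in the direction [i]. A
    derivative of the error that involves [i] is a derivative of the error made
    on this partial derivative; one that does not is recovered from it by the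
    mean value theorem. *)
Lemma separated_approx i n M (m : nat) f (eps : R) : (0 < m)%N ->
  smooth f -> depends_lt i.+1 f -> 0 < eps ->
  exists2 g, separated i g &
    forall s, (size s <= n)%N -> (count_mem i s <= M)%N ->
    forall x, cube m%:R x -> `|iter_partial s (f - g) x| <= eps.
Proof.
move=> m0; elim: M f eps => [|M IH] f eps sf df e0.
  have [g sg Hg] := separated_approx0 n m0 sf df e0.
  exists g => // s sn; rewrite leqn0 => /eqP/count_memPn nis.
  by apply: Hg.
have e'0 : 0 < eps / m%:R by rewrite divr_gt0// ltr0n.
have [g sg gP] := IH _ _ (smooth_partial i sf) (depends_lt_partial i df) e'0.
have [G [sG GE G0]] := separated_antiderivative sg.
pose f0 := f \o set_coord i 0.
have sf0 : smooth f0 by exact: smooth_set_coord.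
have smG := separated_smooth sG.
have sf0G := smoothD sf0 smG.
have sF := smoothB sf sf0G.
have dF : partial i (f - (f0 + G)) = partial i f - g.
  have := iter_partialB [:: i] sf sf0G; rewrite /= => ->.
  rewrite (partialD i sf0 smG) GE partial_set_coord_eq.
  by rewrite [cst 0]/(0 : V -> R) add0r.
exists (f0 + G).
  have := separatedD 1 sf0 (depends_lt_set_coord 0 df) sG.
  rewrite rmorph1 (_ : coord_poly i 1 = 1) ?mul1r//.
  by apply/funext => x; rewrite /coord_poly hornerE.
move=> s sn cs x xm; have [si|nsi] := boolP (i \in s).
  rewrite (iter_partial_rem sF si) dF.
  apply: le_trans (_ : eps / m%:R <= _); last first.
    by rewrite ler_pdivrMr ?ltr0n// ler_peMr ?(ltW e0)// ler1n.
  apply: gP => //; first by rewrite size_rem// (leq_trans (leq_pred _)).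
  by rewrite count_mem_rem eqxx leq_subLR.
have Fs := smooth_iter_partial s sF.
pose F := iter_partial s (f - (f0 + G)).
have F0 : F (set_coord i 0 x) = 0.
  have E := iter_partial_set_coord 0 (f - (f0 + G)) nsi.
  apply: etrans (esym (congr1 (fun H : V -> R => H x) E)) _.
  suff -> : (f - (f0 + G)) \o set_coord i 0 = 0 by rewrite iter_partial0.
  apply/funext => y.
  have yy : set_coord i 0 (set_coord i 0 y) = set_coord i 0 y.
    by apply/rowP => j; rewrite !set_coordE; case: eqVneq.
  have E0 : f (set_coord i 0 y) -
    (f (set_coord i 0 (set_coord i 0 y)) + G (set_coord i 0 y)) = 0.
    by rewrite yy G0 addr0 subrr.
  exact: E0.
have [c ct E] := mvt_partial i (set_coord i 0 x) (x 0 i) Fs.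
have xE : x 0 i *: e i + set_coord i 0 x = x.
  by rewrite /set_coord addrA -scalerDl sub0r subrr scale0r add0r.
rewrite xE -/F F0 subr0 in E.
rewrite [X in `|X|]E normrM -[leRHS](@divfK _ m%:R) ?pnatr_eq0 -?lt0n// ler_pM//.
rewrite -iter_partial_partial// dF; apply: gP => //.
  by move/count_memPn: nsi => ->.
move=> j; rewrite coord_shift set_coordE.
case: eqVneq => _; first by rewrite mulr1 addr0 (le_trans ct).
by rewrite mulr0 add0r.
Qed.

Lemma separated_approximable i g :
  (forall h, smooth h -> depends_lt i h -> approximable h) ->
  separated i g -> approximable g.
Proof.
move=> H; elim=> [|phi h {}g sh dh sg ag]; first exact: approximable_cst.
have su : smooth (coord_poly i (map_poly ratr phi) : V -> R).
  exact: smooth_coord_poly.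
apply: (approximableD (smoothM su sh) (separated_smooth sg)) => //.
exact: approximable_coord_poly (H _ sh dh).
Qed.

(** Induction on the number of variables: the coefficients of a separated
    approximant depend on one variable fewer. *)
Lemma depends_lt_approximable k f : smooth f -> depends_lt k f ->
  approximable f.
Proof.
elim: k f => [|k IH] f sf df.
  have -> : f = cst (f 0) by apply/funext => x; exact: df.
  exact: approximable_cst.
have [kd|dk] := ltnP k d; last first.
  by apply: IH => // x y xy; apply: df => j _; apply: xy; exact: leq_trans dk.
apply: approximable_lim => // n L eps e0.
pose m := (Num.bound `|L|).+1; pose i := Ordinal kd.
have [g sg gP] := separated_approx (i := i) n n (ltn0Sn _ : 0 < m)%N sf df e0.
exists g; split; first exact: separated_smooth sg.
  exact: separated_approximable sg.
move=> s sn x xL; apply: gP => // [|j].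
  exact: leq_trans (count_size _ _) sn.
have Lm : L <= m%:R.
  rewrite (le_trans (ler_norm _))// (le_trans (ltW (archi_boundP _)))//.
  by rewrite ler_nat.
exact: le_trans (xL j) Lm.
Qed.

Lemma smooth_approximable f : smooth f -> approximable f.
Proof.
move=> sf; apply: (@depends_lt_approximable d) => // x y xy; congr f.
by apply/rowP => j; exact: xy.
Qed.

Lemma mpartialE (beta : 'I_d -> nat) :
  exists s, forall f, mpartial beta f = iter_partial s f.
Proof.
rewrite /mpartial; elim: (enum _) => [|i t [s IH]]; first by exists [::].
exists (nseq (beta i) i ++ s) => f /=; rewrite iter_partial_cat -IH.
by elim: (beta i) => //= b ->.
Qed.

End RationalApproximation.

Theorem mainTheorem2 (R : realType) (d : nat) (hd : (0 < d)%N)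
    (f : 'rV[R]_d -> R) (hf : smooth f) :
  exists p : nat -> mpoly.mpoly d rat,
    forall (K : set 'rV[R]_d) (beta : 'I_d -> nat),
      compact K ->
      sup_norm K (fun x => mpartial beta f x
                           - mpartial beta (rat_mpoly_fun (p n)) x)
        @[n --> \oo] --> (0 : R).
Proof.
have /choice[p pP] : forall n : nat, exists p : mpoly.mpoly d rat,
    smooth (rat_mpoly_fun p : 'rV[R]_d -> R) /\
    Cn_le n n%:R n.+1%:R^-1 (f - rat_mpoly_fun p).
  move=> n; have [|p] := smooth_approximable hf n n%:R (_ : 0 < n.+1%:R^-1).
    by rewrite invr_gt0.
  by exists p.
exists p => K beta cK.
have [L KL] : exists L : nat, K `<=` cube L%:R.
  have [M [Mr HM]] := compact_bounded cK.
  exists (Num.bound (M + 1)) => x Kx i.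
  have := HM (M + 1); rewrite ltrDl ltr01 => /(_ isT) /(_ x Kx) /= xM.
  have xi : `|x 0 i| <= `|x|.
    rewrite [leRHS]/Num.norm /= mx_normrE; apply/bigmax_geP; right.
    by exists (0, i).
  have M0 : 0 <= M + 1 by exact: le_trans xM.
  exact: le_trans xi (le_trans xM (ltW (archi_boundP M0))).
have [s sE] := mpartialE R beta.
apply/cvgrPdist_le => eps e0.
near=> n; rewrite sub0r normrN.
have sn : (size s <= n)%N by near: n; exact: nbhs_infty_ge.
have Ln : (L <= n)%N by near: n; exact: nbhs_infty_ge.
have ne : n.+1%:R^-1 <= eps.
  apply: ltW; near: n; exact: (near_infty_natSinv_lt (PosNum e0)).
have [sp fp] := pP n.
have H x : K x -> `|mpartial beta f x - mpartial beta (rat_mpoly_fun (p n)) x| <= eps.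
  move=> Kx; apply: le_trans ne; rewrite !sE.
  have := fp s sn x; rewrite iter_partialB//; apply=> i.
  by rewrite (le_trans (KL _ Kx i))// ler_nat.
rewrite /sup_norm; have [->|K0] := eqVneq K set0.
  by rewrite image_set0 sup0 normr0 ltW.
have [x0 Kx0] : K !=set0 by apply/set0P.
set S := (X in sup X).
have S0 : S !=set0 by eexists; exists x0.
have ubS : ubound S eps by move=> _ [x Kx <-]; exact: H.
rewrite ger0_norm; first exact: ge_sup.
have Sx0 : S `|mpartial beta f x0 - mpartial beta (rat_mpoly_fun (p n)) x0|.
  by exists x0.
apply: le_trans (normr_ge0 _) (ub_le_sup _ Sx0).
by exists eps.
Unshelve. all: by end_near.
Qed.
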